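(* Let $k=\mathbb{C}$, let $S$ be a discrete bounded semilattice and let $A$ be an $S$-graded $k$-algebra. Then $\widehat{S}$ acts on $A$.
   Context: Algebras are unital associative $k$-algebras. An algebra $A$ is $S$-graded if $A=\bigoplus_{s\in S}A_s$ with $A_s$ subspaces such that $A_sA_t\subseteq A_{st}$ for all $s,t\in S$. A bounded semilattice is a semilattice (a partially ordered set in which any two elements have a greatest lower bound, with product $st=\mathrm{glb}\{s,t\}$, or dually least upper bounds) which is a monoid under this product; equivalently, a commutative monoid in which every element is idempotent. Discrete means endowed with the discrete topology. Let $\mathbb{B}=\{z\in\mathbb{C}\mid |z|=1\}\cup\{0\}$, a topological monoid under multiplication. The Pontryagin dual of a topological monoid $S$ is $\widehat{S}=\{\chi:S\to\mathbb{B}\mid\chi\text{ a continuous monoid homomorphism}\}$, a monoid under pointwise multiplication. A monoid $M$ acts on a $k$-algebra $A$ if there is a monoid homomorphism $\alpha:M\to\mathrm{End}(A)$, where $\mathrm{End}(A)$ is the monoid of algebra endomorphisms of $A$. *)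

(* Defs.v *)
From HB Require Import structures.
From mathcomp Require Import all_boot all_order all_algebra.
From mathcomp Require Import complex.
From mathcomp Require Import all_classical all_reals all_analysis.

Set Implicit Arguments.
Unset Strict Implicit.
Unset Printing Implicit Defensive.

Import Order.TTheory GRing.Theory Num.Theory.
Import numFieldNormedType.Exports.

Local Open Scope classical_set_scope.
Local Open Scope ring_scope.

HB.mixin Record isTopologicalMonoid S of Monoid S & Topological S := {
  mulg_continuous : continuous (fun xy : S * S => (xy.1 * xy.2)%g)
}.

#[short(type="topologicalMonoidType")]
HB.structure Definition TopologicalMonoid :=
  {S of Monoid S & Topological S & isTopologicalMonoid S}.

HB.mixin Record Monoid_isBoundedSemilattice S of Monoid S := {
  bslatC : forall x y : S, (x * y = y * x)%g;
  bslatxx : forall x : S, (x * x = x)%g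
}.

#[short(type="boundedSemilatticeType")]
HB.structure Definition BoundedSemilattice :=
  {S of Monoid S & Monoid_isBoundedSemilattice S}.

(* Continuity of the product, required here through TopologicalMonoid, holds   *)
(* automatically for the discrete topology.                                   *)
#[short(type="discreteBoundedSemilatticeType")]
HB.structure Definition DiscreteBoundedSemilattice :=
  {S of BoundedSemilattice S & DiscreteTopology S & TopologicalMonoid S}.

Section CircleWithZero.
Variable R : realType.

(* The alias R[i]^o is the one carrying the topology of the modulus.          *)
Definition circle0_set : set R[i]^o := [set z | `|z| = 1 \/ z = 0].

Definition circle0 : Type := set_type circle0_set.

HB.instance Definition _ := Topological.on circle0.

Definition circle0_val (z : circle0) : R[i] := \val z.

Lemma circle0_val_inj : injective circle0_val.
Proof. exact: val_inj. Qed.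

Lemma circle0_valP (z : circle0) : circle0_set (circle0_val z).
Proof. exact: set_mem (valP z). Qed.

Lemma circle0_mul_subproof (x y : circle0) :
  (circle0_val x * circle0_val y : R[i]^o) \in circle0_set.
Proof.
apply: mem_set; rewrite /circle0_set/=.
have [hx|->] := circle0_valP x; last by right; rewrite mul0r.
have [hy|->] := circle0_valP y; last by right; rewrite mulr0.
by left; rewrite [LHS]normrM hx hy mulr1.
Qed.

Lemma circle0_one_subproof : (1 : R[i]^o) \in circle0_set.
Proof. by apply: mem_set; left; rewrite normr1. Qed.

Definition circle0_mul (x y : circle0) : circle0 :=
  exist (fun z => z \in circle0_set) _ (circle0_mul_subproof x y).

Definition circle0_one : circle0 :=
  exist (fun z => z \in circle0_set) _ circle0_one_subproof.

Lemma circle0_mulA : associative circle0_mul.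
Proof. by move=> x y z; apply: circle0_val_inj; rewrite /circle0_val/= mulrA. Qed.

Lemma circle0_mul1 : left_id circle0_one circle0_mul.
Proof. by move=> x; apply: circle0_val_inj; rewrite /circle0_val/= mul1r. Qed.

Lemma circle0_mulr1 : right_id circle0_one circle0_mul.
Proof. by move=> x; apply: circle0_val_inj; rewrite /circle0_val/= mulr1. Qed.

HB.instance Definition _ :=
  isMonoid.Build circle0 circle0_mulA circle0_mul1 circle0_mulr1.

Lemma circle0_mulC (x y : circle0) : (x * y = y * x)%g.
Proof. by apply: circle0_val_inj; rewrite /circle0_val/= mulrC. Qed.

Lemma circle0_val_continuous : continuous (circle0_val : circle0 -> R[i]^o).
Proof. exact: initial_continuous. Qed.

Lemma circle0_mul_continuous :
  continuous (fun xy : circle0 * circle0 => (xy.1 * xy.2)%g).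
Proof.
apply: (@continuous_comp_initial circle0 _ (R[i]^o : topologicalType) set_val).
move=> xy.
apply: (@cvgM _ _ _ _ (fun xy : circle0 * circle0 => circle0_val xy.1 : R[i]^o)
  (fun xy : circle0 * circle0 => circle0_val xy.2 : R[i]^o)).
- by apply: (continuous_comp _ _); [exact: cvg_fst|exact: circle0_val_continuous].
- by apply: (continuous_comp _ _); [exact: cvg_snd|exact: circle0_val_continuous].
Qed.

HB.instance Definition _ :=
  isTopologicalMonoid.Build circle0 circle0_mul_continuous.

End CircleWithZero.

Coercion circle0_val : circle0 >-> complex.

HB.structure Definition Character (R : realType) (S : topologicalMonoidType) :=
  {chi of @isContinuous S (circle0 R) chi
        & @UMagmaMorphism S (circle0 R) chi}.

Section PontryaginDual.
Variables (R : realType) (S : topologicalMonoidType).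

Definition dual : Type := Character.type R S.

HB.instance Definition _ := gen_eqMixin dual.
HB.instance Definition _ := gen_choiceMixin dual.

Definition dual_fun (chi : dual) : S -> circle0 R := chi.

Lemma dualP (chi psi : dual) : dual_fun chi =1 dual_fun psi -> chi = psi.
Proof.
case: chi psi => [f [[cf] [mf] [uf]]] [g [[cg] [mg] [ug]]] /funext/= fg.
rewrite /dual_fun/= in fg; case: _ / fg in cg mg ug *.
by rewrite (Prop_irrelevance cf cg) (Prop_irrelevance mf mg)
  (Prop_irrelevance uf ug).
Qed.

Definition one_char (_ : S) : circle0 R := 1%g.

Lemma one_char_continuous : continuous one_char.
Proof. by move=> x; exact: cvg_cst. Qed.

HB.instance Definition _ := isContinuous.Build S (circle0 R) one_char
  one_char_continuous.

Lemma one_char_monoid_morphism : monoid.monoid_morphism one_char.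
Proof. by split=> // x y; rewrite /one_char mul1g. Qed.

HB.instance Definition _ := isUMagmaMorphism.Build S (circle0 R) one_char
  one_char_monoid_morphism.

Definition mul_char (chi psi : dual) (x : S) : circle0 R :=
  (dual_fun chi x * dual_fun psi x)%g.

Lemma mul_char_continuous chi psi : continuous (mul_char chi psi).
Proof.
move=> x; have cchi := @cts_fun _ _ chi x; have cpsi := @cts_fun _ _ psi x.
have /= := @cvg_comp _ _ _ _ _ _ _ _ (cvg_pair cchi cpsi)
  (mulg_continuous (dual_fun chi x, dual_fun psi x)).
exact.
Qed.

HB.instance Definition _ chi psi := isContinuous.Build S (circle0 R)
  (mul_char chi psi) (@mul_char_continuous chi psi).

Lemma mul_char_monoid_morphism chi psi : monoid.monoid_morphism (mul_char chi psi).
Proof.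
rewrite /mul_char /dual_fun; split=> [|x y]; first by rewrite !gmulf1 mul1g.
rewrite !gmulfM !mulgA; congr (_ * _)%g.
by rewrite -!mulgA; congr (_ * _)%g; rewrite circle0_mulC.
Qed.

HB.instance Definition _ chi psi := isUMagmaMorphism.Build S (circle0 R)
  (mul_char chi psi) (mul_char_monoid_morphism chi psi).

Definition dual_one : dual := one_char.
Definition dual_mul (chi psi : dual) : dual := mul_char chi psi.

Lemma dual_mulA : associative dual_mul.
Proof. by move=> f g h; apply: dualP => x; exact: mulgA. Qed.

Lemma dual_mul1 : left_id dual_one dual_mul.
Proof. by move=> f; apply: dualP => x; exact: mul1g. Qed.

Lemma dual_mulr1 : right_id dual_one dual_mul.
Proof. by move=> f; apply: dualP => x; exact: mulg1. Qed.

HB.instance Definition _ := isMonoid.Build dual dual_mulA dual_mul1 dual_mulr1.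

End PontryaginDual.

Coercion dual_fun : dual >-> Funclass.

Section Endomorphisms.
Variables (K : comNzRingType) (A : algType K).

Definition algEnd : Type := {lrmorphism A -> A}.

HB.instance Definition _ := gen_eqMixin algEnd.
HB.instance Definition _ := gen_choiceMixin algEnd.

Definition algEnd_fun (f : algEnd) : A -> A := f.

Lemma algEndP (f g : algEnd) : algEnd_fun f =1 algEnd_fun g -> f = g.
Proof.
rewrite /algEnd_fun; case: f g => [f cf] [g cg] /funext/= fg.
case: _ / fg in cg *; congr (GRing.LRMorphism.Pack _).
case: cf cg => [[?] [?] [?]] [[?] [?] [?]].
by congr GRing.LRMorphism.Class; f_equal; exact: Prop_irrelevance.
Qed.

Definition algEnd_one : algEnd := idfun.
Definition algEnd_mul (f g : algEnd) : algEnd := f \o g.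

Lemma algEnd_mulA : associative algEnd_mul.
Proof. by move=> f g h; apply: algEndP. Qed.

Lemma algEnd_mul1 : left_id algEnd_one algEnd_mul.
Proof. by move=> f; apply: algEndP. Qed.

Lemma algEnd_mulr1 : right_id algEnd_one algEnd_mul.
Proof. by move=> f; apply: algEndP. Qed.

HB.instance Definition _ :=
  isMonoid.Build algEnd algEnd_mulA algEnd_mul1 algEnd_mulr1.

(* Endomorphisms of A as an algebra without unit: f 1 need not be 1. They are  *)
(* needed because a grading by a monoid need not have 1 in degree 1; when it   *)
(* does not, multiplying degree s by chi s need not fix the unit of A: take    *)
(* S = {1, e}, A concentrated in degree e, and chi e = 0.                      *)
Record nuAlgEnd : Type := NuAlgEnd {
  nuAlgEnd_lin :> {linear A -> A};
  nuAlgEndM : forall a b, nuAlgEnd_lin (a * b) = nuAlgEnd_lin a * nuAlgEnd_lin b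
}.

HB.instance Definition _ := gen_eqMixin nuAlgEnd.
HB.instance Definition _ := gen_choiceMixin nuAlgEnd.

Lemma nuAlgEndP (f g : nuAlgEnd) : f =1 g -> f = g.
Proof.
case: f g => [f fM] [g gM] /= fg.
have {}fg : f = g.
  case: f g fg {fM gM} => [f cf] [g cg] /funext/= fg.
  case: _ / fg in cg *; congr (GRing.Linear.Pack _).
  case: cf cg => [[?] [?]] [[?] [?]].
  by congr GRing.Linear.Class; f_equal; exact: Prop_irrelevance.
by case: _ / fg in gM *; congr NuAlgEnd; exact: Prop_irrelevance.
Qed.

Definition nuAlgEnd_one : nuAlgEnd := @NuAlgEnd idfun (fun _ _ => erefl).

Lemma nuAlgEnd_mul_subproof (f g : nuAlgEnd) a b :
  (f \o g) (a * b) = (f \o g) a * (f \o g) b.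
Proof. by rewrite /= !nuAlgEndM. Qed.

Definition nuAlgEnd_mul (f g : nuAlgEnd) : nuAlgEnd :=
  @NuAlgEnd (f \o g) (nuAlgEnd_mul_subproof f g).

Lemma nuAlgEnd_mulA : associative nuAlgEnd_mul.
Proof. by move=> f g h; apply: nuAlgEndP. Qed.

Lemma nuAlgEnd_mul1 : left_id nuAlgEnd_one nuAlgEnd_mul.
Proof. by move=> f; apply: nuAlgEndP. Qed.

Lemma nuAlgEnd_mulr1 : right_id nuAlgEnd_one nuAlgEnd_mul.
Proof. by move=> f; apply: nuAlgEndP. Qed.

HB.instance Definition _ :=
  isMonoid.Build nuAlgEnd nuAlgEnd_mulA nuAlgEnd_mul1 nuAlgEnd_mulr1.

End Endomorphisms.

Coercion algEnd_fun : algEnd >-> Funclass.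

Definition monoid_action (M : monoidType) (K : comNzRingType) (A : algType K) :=
  UMagmaMorphism.type M (algEnd A).

Definition nu_monoid_action (M : monoidType) (K : comNzRingType)
    (A : algType K) :=
  UMagmaMorphism.type M (nuAlgEnd A).

Section Gradings.
Variables (S : monoidType) (K : comNzRingType) (A : algType K).

Definition direct_sum_decomposition (G : S -> submodClosed A) : Prop :=
  forall a : A, exists! f : S -> A,
    [/\ finite_set [set s | f s != 0], forall s, f s \in G s
      & a = \sum_(s \in [set: S]) f s].

Record is_grading (G : S -> submodClosed A) : Prop := IsGrading {
  grading_direct_sum : direct_sum_decomposition G;
  gradingM : forall s t a b, a \in G s -> b \in G t -> a * b \in G (s * t)%g
}.

End Gradings.

(* The action dual to the grading: chi is scalar multiplication by chi s on    *)
(* the component of degree s.                                                  *)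
Definition acts_by_degree (R : realType) (S : topologicalMonoidType)
    (A : algType R[i]) (G : S -> submodClosed A)
    (alpha : dual R S -> A -> A) : Prop :=
  forall (chi : dual R S) (s : S) (a : A),
    a \in G s -> alpha chi a = (chi s : R[i]) *: a.

(* Main.v *)
Require Import Defs.
From HB Require Import structures.
From mathcomp Require Import all_boot all_order all_algebra.
From mathcomp Require Import complex.
From mathcomp Require Import all_classical all_reals all_analysis.

(** A character [chi] of [S] has values in the ring of scalars, so it can be
used as a family of weights: multiply the component of degree [s] by [chi s].
On [a] of degree [s] and [b] of degree [t], for which [a * b] has degree
[s * t], multiplicativity of this rescaling is the identity
[chi (s * t) = chi s * chi t]; that it respects products of characters and the
trivial character is the fact that the dual has the pointwise structure.  All
these identities are between additive maps, so it is enough to check them on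
homogeneous elements ([direct_sum_ind]), where the rescaling is a scalar
multiplication ([rescale_homog]).  This gives the action by endomorphisms that
need not preserve the unit.

The unit is preserved by every character when it has degree [1], because
[chi 1 = 1]; the same maps are then an action by unital endomorphisms.  When
the unit does not have degree [1], the degrees impose no condition on the
action by unital endomorphisms, and the trivial action will do. *)

Set Implicit Arguments.
Unset Strict Implicit.
Unset Printing Implicit Defensive.

Import GRing.Theory.

Local Open Scope classical_set_scope.
Local Open Scope ring_scope.

(** * Sums of families of finite support *)

(** A family of finite support is summed over a finite set containing the
supports of both summands, since a sum over all of [I] of a family with infinite
support is [0] by convention, and so is not additive in general. *)
Lemma fsum_linear_comb (K : nzRingType) (V : lmodType K) (I : choiceType)
    (c : K) (f g : I -> V) :
    finite_set [set i | f i != 0] -> finite_set [set i | g i != 0] ->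
  \sum_(i \in [set: I]) (c *: f i + g i) =
  c *: (\sum_(i \in [set: I]) f i) + \sum_(i \in [set: I]) g i.
Proof.
move=> finf fing.
pose D := [set i | f i != 0] `|` [set i | g i != 0].
have finD : finite_set D by rewrite finite_setU.
have zf i : ~ D i -> f i = 0.
  by move=> nD; apply/eqP/negPn/negP => fi; apply: nD; left.
have zg i : ~ D i -> g i = 0.
  by move=> nD; apply/eqP/negPn/negP => gi; apply: nD; right.
have restrict (h : I -> V) : (forall i, ~ D i -> h i = 0) ->
    \sum_(i \in [set: I]) h i = \sum_(i <- finmap.enum_fset (fset_set D)) h i.
  move=> hD; rewrite -fsbig_finite //; apply/esym/fsbig_widen => // i [_].
  exact: hD.
rewrite !restrict // => [|i nD]; last by rewrite zf // zg // scaler0 addr0.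
by rewrite big_split -scaler_sumr.
Qed.

Lemma fsum_single (V : nmodType) (I : choiceType) (i : I) (v : V) :
  \sum_(j \in [set: I]) (if j == i then v else 0) = v.
Proof.
rewrite -(fsbig_widen [set i]) ?fsbig_set1 ?eqxx // => j /= [_ ji].
by case: eqP.
Qed.

(** * Rescaling the components of a direct sum decomposition *)

Section Rescaling.
Variables (S : monoidType) (K : comNzRingType) (A : algType K).
Variables (G : S -> submodClosed A) (dsumG : direct_sum_decomposition G).

Definition component (a : A) : S -> A := projT1 (cid (dsumG a)).

Lemma componentP (a : A) :
  [/\ finite_set [set s | component a s != 0], forall s, component a s \in G s
    & a = \sum_(s \in [set: S]) component a s].
Proof. by rewrite /component; case: cid => f []. Qed.

Lemma component_unique (a : A) (f : S -> A) :
    finite_set [set s | f s != 0] -> (forall s, f s \in G s) ->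
  a = \sum_(s \in [set: S]) f s -> component a = f.
Proof. by rewrite /component; case: cid => g [? +] ? ? ?; apply. Qed.

(** The right-hand side is a decomposition of [c *: a + b], and decompositions
are unique. *)
Lemma component_linear (c : K) (a b : A) (s : S) :
  component (c *: a + b) s = c *: component a s + component b s.
Proof.
have [fina Ga sa] := componentP a; have [finb Gb sb] := componentP b.
rewrite (@component_unique _ (fun s => c *: component a s + component b s)) //.
- apply: (@sub_finite_set _ _
    ([set t | component a t != 0] `|` [set t | component b t != 0])).
    move=> t /=; have [->|] := eqVneq (component a t) 0; last by left.
    by rewrite scaler0 add0r; right.
  by rewrite finite_setU.
- by move=> t; rewrite rpredD ?rpredZ.
- by rewrite fsum_linear_comb // -sa -sb.
Qed.

Lemma component_homog (s t : S) (a : A) :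
  a \in G s -> component a t = if t == s then a else 0.
Proof.
move=> Gsa.
rewrite (@component_unique _ (fun t => if t == s then a else 0)) //.
- apply: (@sub_finite_set _ _ [set s]) => // r /=.
  by case: (r =P s) => // _; rewrite eqxx.
- by move=> r; case: eqP => [->//|_]; exact: rpred0.
- by rewrite fsum_single.
Qed.

(** Every element is a finite sum of homogeneous ones, so a property of
homogeneous elements that is stable under sums holds everywhere; in particular
an additive map is determined by its values on homogeneous elements. *)
Lemma direct_sum_ind (P : A -> Prop) :
    P 0 -> (forall a b, P a -> P b -> P (a + b)) ->
  (forall s a, a \in G s -> P a) -> forall a, P a.
Proof.
move=> P0 PD Phomog a; have [fina Ga sa] := componentP a.
rewrite [X in P X]sa -(fsbig_widen [set s | component a s != 0]) //; last first.
  by move=> s [_ /negP]; rewrite negbK => /eqP.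
by rewrite fsbig_finite //; elim/big_ind: _ => // s _; exact: Phomog (Ga s).
Qed.

Definition rescale (w : S -> K) (a : A) : A :=
  \sum_(s \in [set: S]) w s *: component a s.

Lemma rescale_linear (w : S -> K) : linear (rescale w).
Proof.
move=> c a b; rewrite /rescale -fsum_linear_comb.
- apply: eq_fsbigr => s _.
  by rewrite component_linear scalerDr !scalerA mulrC.
- have [fina _ _] := componentP a; apply: sub_finite_set fina => s /=.
  by apply: contraNneq => ->; rewrite scaler0.
- have [finb _ _] := componentP b; apply: sub_finite_set finb => s /=.
  by apply: contraNneq => ->; rewrite scaler0.
Qed.

HB.instance Definition _ (w : S -> K) :=
  GRing.isLinear.Build K A A *:%R (rescale w) (rescale_linear w).

Lemma rescale_homog (w : S -> K) (s : S) (a : A) :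
  a \in G s -> rescale w a = w s *: a.
Proof.
move=> Gsa; rewrite -[RHS](fsum_single s); apply: eq_fsbigr => t _.
by rewrite (component_homog t Gsa); case: eqP => [->//|_]; rewrite scaler0.
Qed.

Lemma rescale1 (w : S -> K) : (forall s, w s = 1) -> rescale w =1 id.
Proof.
move=> w1; elim/direct_sum_ind => [|a b IHa IHb|s a Gsa].
- by rewrite raddf0.
- by rewrite raddfD /= IHa IHb.
- by rewrite (rescale_homog w Gsa) w1 scale1r.
Qed.

Lemma rescale_comp (w v u : S -> K) : (forall s, u s = w s * v s) ->
  rescale u =1 rescale w \o rescale v.
Proof.
move=> uE; elim/direct_sum_ind => [|a b IHa IHb|s a Gsa].
- by rewrite /= !raddf0.
- by rewrite raddfD /= IHa IHb !raddfD.
- by rewrite /= !(rescale_homog _ Gsa) linearZ /= (rescale_homog _ Gsa)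
    scalerA uE mulrC.
Qed.

(** Both sides are additive in [a] and in [b], so two inductions reduce this to
homogeneous factors, whose product is homogeneous of degree the product of the
degrees. *)
Lemma rescaleM (w : S -> K) :
    (forall s t a b, a \in G s -> b \in G t -> a * b \in G (s * t)%g) ->
    (forall s t, w (s * t)%g = w s * w t) ->
  {morph rescale w : a b / a * b}.
Proof.
move=> GM wM a b.
elim/direct_sum_ind: a => [|a a' IHa IHa'|s a Gsa].
- by rewrite mul0r raddf0 mul0r.
- by rewrite mulrDl !raddfD /= IHa IHa' mulrDl.
elim/direct_sum_ind: b => [|b b' IHb IHb'|t b Gtb].
- by rewrite mulr0 raddf0 mulr0.
- by rewrite mulrDr !raddfD /= IHb IHb' mulrDr.
by rewrite (rescale_homog _ (GM _ _ _ _ Gsa Gtb)) (rescale_homog _ Gsa)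
  (rescale_homog _ Gtb) wM -scalerAl -scalerAr scalerA.
Qed.

End Rescaling.

(** * The action of the dual on a graded algebra *)

Section DualAction.
Variables (R : realType) (S : topologicalMonoidType) (A : algType R[i]).
Variables (G : S -> submodClosed A) (gradA : is_grading G).

Definition char_weight (chi : dual R S) (s : S) : R[i] := chi s.

Lemma char_weight1 (chi : dual R S) : char_weight chi 1%g = 1.
Proof. by rewrite /char_weight /dual_fun gmulf1. Qed.

Lemma char_weightM (chi : dual R S) (s t : S) :
  char_weight chi (s * t)%g = char_weight chi s * char_weight chi t.
Proof. by rewrite /char_weight /dual_fun gmulfM. Qed.

Definition dual_rescale (chi : dual R S) : A -> A :=
  rescale (grading_direct_sum gradA) (char_weight chi).

HB.instance Definition _ (chi : dual R S) :=
  GRing.Linear.on (dual_rescale chi).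

Lemma dual_rescale_acts_by_degree : acts_by_degree G dual_rescale.
Proof. by move=> chi s a; exact: rescale_homog. Qed.

Lemma dual_rescaleM (chi : dual R S) : {morph dual_rescale chi : a b / a * b}.
Proof. by apply: rescaleM; [exact: gradingM|exact: char_weightM]. Qed.

Lemma dual_rescale_one : dual_rescale 1%g =1 id.
Proof. exact: rescale1. Qed.

Lemma dual_rescale_mul (chi psi : dual R S) :
  dual_rescale (chi * psi)%g =1 dual_rescale chi \o dual_rescale psi.
Proof. exact: rescale_comp. Qed.

Definition nu_dual_rescale (chi : dual R S) : nuAlgEnd A :=
  NuAlgEnd (dual_rescaleM chi).

Lemma nu_dual_rescale_monoid_morphism : monoid.monoid_morphism nu_dual_rescale.
Proof.
split=> [|chi psi]; apply: nuAlgEndP => a; first exact: dual_rescale_one.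
exact: dual_rescale_mul.
Qed.

HB.instance Definition _ := isUMagmaMorphism.Build (dual R S) (nuAlgEnd A)
  nu_dual_rescale nu_dual_rescale_monoid_morphism.

Lemma nu_dual_action :
  exists beta : nu_monoid_action (dual R S) A,
    acts_by_degree G (fun chi a => beta chi a).
Proof. by exists nu_dual_rescale; exact: dual_rescale_acts_by_degree. Qed.

Section Unital.
Variable G11 : 1 \in G 1%g.

(** The unit has degree [1], so it is multiplied by [chi 1 = 1]. *)
Lemma dual_rescale_monoid_morphism (chi : dual R S) :
  GRing.monoid_morphism (dual_rescale chi).
Proof.
split; last exact: dual_rescaleM.
by rewrite (dual_rescale_acts_by_degree chi G11) [X in X *: _]char_weight1
  scale1r.
Qed.

(** An alias of [dual_rescale] to carry the structure of unital morphism, which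
exists only under [G11]. *)
Definition unital_dual_rescale (chi : dual R S) : A -> A := dual_rescale chi.

HB.instance Definition _ (chi : dual R S) :=
  GRing.Linear.on (unital_dual_rescale chi).
HB.instance Definition _ (chi : dual R S) :=
  GRing.isMonoidMorphism.Build A A (unital_dual_rescale chi)
    (dual_rescale_monoid_morphism chi).

Definition alg_dual_rescale (chi : dual R S) : algEnd A :=
  (unital_dual_rescale chi : {lrmorphism A -> A}).

Lemma alg_dual_rescale_monoid_morphism :
  monoid.monoid_morphism alg_dual_rescale.
Proof.
split=> [|chi psi]; apply: algEndP => a; first exact: dual_rescale_one.
exact: dual_rescale_mul.
Qed.

HB.instance Definition _ := isUMagmaMorphism.Build (dual R S) (algEnd A)
  alg_dual_rescale alg_dual_rescale_monoid_morphism.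

Lemma unital_dual_action :
  exists alpha : monoid_action (dual R S) A,
    acts_by_degree G (fun chi a => alpha chi a).
Proof. by exists alg_dual_rescale; exact: dual_rescale_acts_by_degree. Qed.

End Unital.
End DualAction.

(** * The trivial action *)

Section TrivialAction.
Variables (M : monoidType) (K : comNzRingType) (A : algType K).

Definition trivial_act (_ : M) : algEnd A := 1%g.

Lemma trivial_act_monoid_morphism : monoid.monoid_morphism trivial_act.
Proof. by split=> // x y; rewrite /trivial_act mul1g. Qed.

HB.instance Definition _ := isUMagmaMorphism.Build M (algEnd A) trivial_act
  trivial_act_monoid_morphism.

Definition trivial_action : monoid_action M A := trivial_act.

End TrivialAction.

Theorem corollary3p15 (R : realType) (S : discreteBoundedSemilatticeType)
    (A : algType R[i]) (G : S -> submodClosed A) (gradA : is_grading G) :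
  (exists alpha : monoid_action (dual R S) A,
      1 \in G 1%g -> acts_by_degree G (fun chi a => alpha chi a)) /\
  (exists beta : nu_monoid_action (dual R S) A,
      acts_by_degree G (fun chi a => beta chi a)).
Proof.
split; last exact: nu_dual_action gradA.
have [G11|nG11] := boolP (1 \in G 1%g).
  by have [alpha alphaG] := unital_dual_action gradA G11; exists alpha.
by exists (trivial_action (dual R S) A).
Qed.
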